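(* There are infinitely many isomorphism classes of finite groups $G$ with the following property: if $H$ is a finite group satisfying $\Delta_G^c \cong \Delta_H^c$, then $G \cong H$. Indeed, this is possible with $G$ metacyclic: there are infinitely many isomorphism classes of metacyclic finite groups $G$ with this property.
   Context: For a finite group $G$, the co-intersection graph $\Delta_G^c$ is the simple graph whose vertices are the nontrivial proper subgroups of $G$, two distinct subgroups being adjacent if and only if they intersect trivially. A group is metacyclic if it has a cyclic normal subgroup with cyclic quotient. *)

(* Defs.v *)
From HB Require Import structures.
From mathcomp Require Import all_boot all_fingroup all_solvable.

Set Implicit Arguments.
Unset Strict Implicit.
Unset Printing Implicit Defensive.

Local Open Scope group_scope.

Record sgraph := SGraph {
  vertex :> finType;
  adj : rel vertex;
  adj_sym : symmetric adj;
  adj_irrefl : irreflexive adj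
}.

Definition graph_iso (A B : sgraph) : Prop :=
  exists f : A -> B,
    bijective f /\ forall x y : A, adj (f x) (f y) = adj x y.

Section CoIntersectionGraph.

Variables (gT : finGroupType) (G : {group gT}).

Definition coint_vertex : finType :=
  {K : {group gT} | (K :!=: 1) && (K \proper G)}.

Definition coint_adj : rel coint_vertex :=
  fun H K => (H != K) && (val H :&: val K == 1).

Lemma coint_adj_sym : symmetric coint_adj.
Proof. by move=> H K; rewrite /coint_adj eq_sym setIC. Qed.

Lemma coint_adj_irrefl : irreflexive coint_adj.
Proof. by move=> H; rewrite /coint_adj eqxx. Qed.

Definition coint_graph : sgraph := SGraph coint_adj_sym coint_adj_irrefl.

End CoIntersectionGraph.

Definition determined_by_coint_graph (gT : finGroupType) (G : {group gT}) :
    Prop :=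
  forall (hT : finGroupType) (H : {group hT}),
    graph_iso (coint_graph G) (coint_graph H) -> G \isog H.

(* The groups may live in different ambient types, so an infinite set of
   isomorphism classes is given by a sequence of pairwise non-isomorphic
   representatives. *)
Definition infinitely_many_groups_up_to_isog
    (P : forall gT : finGroupType, {group gT} -> Prop) : Prop :=
  exists (gT : nat -> finGroupType) (G : forall n : nat, {group gT n}),
    (forall n : nat, P (gT n) (G n)) /\
    (forall m n : nat, G m \isog G n -> m = n).

(* Main.v *)
(** For k > 1 let G be the semidirect product of C_3 by C_{2^k}, the generator
    of C_{2^k} acting by inversion.  Every nontrivial subgroup other than S = C_3
    has even order, hence contains the unique involution, so the co-intersection
    graph is a star centred at S with k + 2 leaves together with k - 1 isolated
    vertices.

    Conversely, if the graph of H has this shape, its centre S has prime order,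
    and H has exactly one other subgroup R of prime order, since distinct
    subgroups of prime order are adjacent.  Their orders r and s differ (otherwise
    R and S commute, and a diagonal subgroup of RS is a third one), S is a
    normal Sylow subgroup, and H = S T with T a Sylow r-subgroup.  The leaves
    are the nontrivial r-subgroups, while S and the isolated vertices are the
    S U with U a proper subgroup of T; thus exactly two r-subgroups are not
    contained in T.
    The s - 1 Sylow subgroups other than T are among them, so s = 3 and r = 2.
    All 2-subgroups outside T are then Sylow, which forces T to be cyclic, and
    counting its subgroups gives #|T| = 2 ^ k. *)
Require Import Defs.
From mathcomp Require Import all_boot all_fingroup all_solvable zmodp.

Set Implicit Arguments.
Unset Strict Implicit.
Unset Printing Implicit Defensive.

Local Open Scope group_scope.

(* The isolated vertices are counted in [e], together with the centre [c]. *)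
Definition is_star (A : sgraph) (d e : nat) : Prop :=
  exists c : A, [/\ forall x y : A, adj x y -> x = c \/ y = c,
    #|[set v | adj c v]| = d & #|[set v | ~~ adj c v]| = e].

Lemma is_star_iso (A B : sgraph) d e :
  graph_iso A B -> is_star A d e -> is_star B d e.
Proof.
case=> f [[g fK gK] fA] [c [cP <- <-]].
have adjg x y : adj x y = adj (g x) (g y) by rewrite -fA !gK.
exists (f c); split=> [x y||].
- by rewrite adjg => /cP[] <-; rewrite gK; [left|right].
- rewrite -(card_imset _ (can_inj gK)); apply: eq_card => v.
  by rewrite (can2_imset_pre _ gK fK) !inE fA.
rewrite -(card_imset _ (can_inj gK)); apply: eq_card => v.
by rewrite (can2_imset_pre _ gK fK) !inE fA.
Qed.

(** * Counting vertices when the kernel of a semidirect product has prime order *)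

Section PrimeKernel.

Variables (gT : finGroupType) (G S T : {group gT}) (r : nat).
Hypotheses (defG : S ><| T = G) (prS : prime #|S|).
Hypotheses (rT : r.-group T) (r'S : r^'.-group S).

(** If [S] is not inside [K], it meets [K] trivially because its order is prime. Then [#|S| * #|K|]
    is the order of the subgroup [S <*> K], so it divides [#|S| * #|T|], and [#|K|] divides
    [#|T|]. *)
Lemma pgroup_prime_kernel (K : {group gT}) :
  K \subset G -> r.-group K = ~~ (S \subset K).
Proof.
move=> sKG; have [_ mulST _ tiST] := sdprodP defG.
apply/idP/idP=> [rK|nSK].
  apply: contraTN prS => /pgroupS/(_ rK) rS.
  by rewrite -(setIid S) (coprime_TIg (pnat_coprime rS r'S)) cards1.
have tiSK : S :&: K = 1 := prime_TIg prS nSK.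
apply: pnat_dvd rT.
rewrite -(@dvdn_pmul2l #|S|) ?cardG_gt0 // -(TI_cardMg tiSK) (sdprod_card defG).
have nSG : S <| G by have [] := sdprod_context defG.
rewrite -norm_joinEr ?(subset_trans sKG (normal_norm nSG)) //.
by apply: cardSg; rewrite join_subG (normal_sub nSG).
Qed.

Lemma TI_prime_kernel (K : {group gT}) :
  K \subset G -> (S :&: K == 1) = r.-group K.
Proof.
move=> sKG; rewrite pgroup_prime_kernel //.
have [sSK|nSK] := boolP (S \subset K); last by rewrite (prime_TIg prS nSK) eqxx.
by rewrite (setIidPl sSK); apply: contraTF prS => /eqP->; rewrite cards1.
Qed.

Variable c : coint_vertex G.
Hypothesis valc : val c = S.

(** The neighbours of [c] are the nontrivial [r]-subgroups; the successor accounts for the trivial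
    one. *)
Lemma star_degree :
  #|[set v | coint_adj c v]|.+1 =
  #|[set K in subgroups G | r.-group K]|.
Proof.
rewrite (cardsD1 1%G [set K in _ | _]) !inE sub1G pgroup1 add1n.
congr _.+1; rewrite -(card_imset _ val_inj); apply: eq_card => K.
apply/imsetP/idP=> [[v + ->]|].
  rewrite !inE /= /coint_adj valc; case/andP=> _.
  case/andP: (valP v) => nt1 /proper_sub sKG.
  by rewrite TI_prime_kernel // sKG -val_eqE /= nt1 => ->.
rewrite !inE -val_eqE /= => /and3P[nt1 sKG rK].
have tiSK : S :&: K == 1 by rewrite TI_prime_kernel.
have prK : (K :!=: 1) && (K \proper G).
  rewrite nt1 properEneq sKG andbT; apply: contraTneq rK => ->.
  by rewrite pgroup_prime_kernel // negbK; have [/andP[]] := sdprod_context defG.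
exists (Sub K prK) => //; rewrite inE /= /coint_adj valc /= tiSK andbT.
apply: contraTneq rK => /(congr1 val); rewrite valc /= => <-.
by rewrite pgroup_prime_kernel ?subxx //; have [/andP[]] := sdprod_context defG.
Qed.

(** The map from [U] to [S <*> U] is a bijection from the subgroups of [T] to those of [G]
    containing [S], with inverse given by intersection with [T]. The successor accounts for [G]
    itself, which is not a vertex. *)
Lemma star_codegree :
  #|[set v | ~~ coint_adj c v]|.+1 = #|subgroups T|.
Proof.
have [nSG sTG mulST nST tiST] := sdprod_context defG.
have sSG := normal_sub nSG.
have joinS (U : {group gT}) : U \subset T -> (S <*> U) :&: T = U.
  move=> sUT; rewrite norm_joinEr ?(subset_trans sUT) //.
  by rewrite setIC -group_modr // setIC tiST mul1g.
have -> : #|subgroups T| = #|[set K in subgroups G | S \subset K]|.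
  have injJ : {in subgroups T &, injective (fun U : {group gT} => (S <*> U)%G)}.
    move=> U V; rewrite !inE => /joinS jU /joinS jV /(congr1 val) /= E.
    by apply: val_inj; rewrite /= -jU E jV.
  rewrite -(card_in_imset injJ); apply: eq_card => K.
  apply/imsetP/idP=> [[U + ->]|].
    rewrite !inE => sUT; rewrite joing_subl join_subG sSG.
    by rewrite (subset_trans sUT).
  rewrite !inE => /andP[sKG sSK]; exists (K :&: T)%G; first by rewrite inE subsetIr.
  apply: val_inj => /=; rewrite norm_joinEr /=; last first.
    by rewrite (subset_trans (subsetIr _ _)).
  by rewrite (setIC K) group_modl // mulST (setIidPr sKG).
rewrite (cardsD1 G [set K in _ | _]) !inE subxx sSG add1n.
congr _.+1; rewrite -(card_imset _ val_inj); apply: eq_card => K.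
apply/imsetP/idP=> [[v + ->]|].
  rewrite !inE /= /coint_adj valc.
  case/andP: (valP v) => nt1 prK; have sKG := proper_sub prK.
  rewrite -val_eqE /= (proper_neq prK) sKG /=.
  rewrite negb_and negbK TI_prime_kernel // pgroup_prime_kernel // negbK.
  by case/orP=> // /eqP <-; rewrite valc.
rewrite !inE -val_eqE /= => /and3P[ntG sKG sSK].
have prK : (K :!=: 1) && (K \proper G).
  rewrite properEneq ntG sKG !andbT.
  by apply: contraTneq prS => K1; move: sSK; rewrite K1 subG1 => /eqP->; rewrite cards1.
exists (Sub K prK) => //; rewrite inE /= /coint_adj valc /=.
by rewrite TI_prime_kernel // pgroup_prime_kernel // sSK andbF.
Qed.

End PrimeKernel.

(** * Subgroups of cyclic [p]-groups, and groups with two subgroups of prime order *)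

Lemma card_subgroups_cyclic_pgroup (gT : finGroupType) (T : {group gT}) p m :
  prime p -> cyclic T -> #|T| = (p ^ m)%N -> #|subgroups T| = m.+1.
Proof.
move=> p_pr cT oT; have p_gt1 := prime_gt1 p_pr.
pose f (K : {group gT}) : 'I_m.+1 := inord (logn p #|K|).
have oK (K : {group gT}) : K \subset T ->
    exists2 i, (i <= m)%N & #|K| = (p ^ i)%N.
  by move=> sKT; apply/(dvdn_pfactor _ _ p_pr); rewrite -oT cardSg.
have fE (K : {group gT}) : K \subset T -> #|K| = (p ^ f K)%N.
  by case/oK=> i le_im eqK; rewrite /f eqK pfactorK // inordK.
have injf : {in subgroups T &, injective f}.
  move=> K L; rewrite !inE => sKT sLT E; apply: val_inj; apply/eqP => /=.
  by rewrite (eq_subG_cyclic cT) // (fE K) // (fE L) // E.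
rewrite -(card_in_imset injf) -[RHS]card_ord; apply: eq_card => i; rewrite inE.
have [x defT] := cyclicP cT.
have ox : #[x] = (p ^ m)%N by rewrite orderE -defT.
have di : (p ^ i %| #[x])%N by rewrite ox dvdn_exp2l // -ltnS.
have oxi : #|<[x ^+ (#[x] %/ p ^ i)]>| = (p ^ i)%N.
  by rewrite -orderE orderXdiv ?dvdn_div // divnA // mulKn // order_gt0.
apply/imsetP; exists <[x ^+ (#[x] %/ p ^ i)]>%G.
  by rewrite inE defT cycleX.
by apply: ord_inj; rewrite inordK /= oxi pfactorK.
Qed.

Lemma prime_subgroup (gT : finGroupType) (K : {group gT}) :
  K :!=: 1 -> exists P : {group gT}, prime #|P| /\ P \subset K.
Proof.
rewrite -cardG_gt1 => oK; have p_pr := pdiv_prime oK.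
have [x Kx ox] := Cauchy p_pr (pdiv_dvd _).
by exists <[x]>%G; rewrite cycle_subG -orderE ox.
Qed.

Lemma star_TI (gT : finGroupType) (G : {group gT}) (c : coint_vertex G) :
  (forall u v : coint_vertex G, coint_adj u v -> u = c \/ v = c) ->
  forall K L : {group gT}, K :!=: 1 -> L :!=: 1 -> K \proper G -> L \proper G ->
  K :&: L = 1 -> K = val c \/ L = val c.
Proof.
move=> cP K L ntK ntL prK prL tiKL.
have vK : (K :!=: 1) && (K \proper G) by rewrite ntK.
have vL : (L :!=: 1) && (L \proper G) by rewrite ntL.
have := cP (Sub K vK) (Sub L vL); rewrite /coint_adj /= tiKL eqxx andbT.
case=> [|<-|<-]; [|by left|by right].
by apply: contra_neq ntK => -[E]; rewrite -tiKL -E setIid.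
Qed.

Lemma two_prime_subgroups_order (gT : finGroupType) (G R S : {group gT}) :
  R \subset G -> S \subset G -> prime #|R| -> prime #|S| -> R != S ->
  (forall L : {group gT}, L \subset G -> prime #|L| -> L = S \/ L = R) ->
  #|R| != #|S|.
Proof.
move=> sRG sSG prR prS nRS minP; apply/eqP=> oRS.
(* Conjugation by an element of [B] permutes the two subgroups and fixes [B], hence fixes [A] as
   well. *)
have nJ (A B : {group gT}) : A \subset G -> B \subset G -> prime #|A| ->
    A != B -> (forall L : {group gT}, L \subset G -> prime #|L| ->
       L = A \/ L = B) -> B \subset 'N(A).
  move=> sAG sBG prA nAB mAB; apply/subsetP=> h Bh; rewrite inE.
  have sAJ : A :^ h \subset G.
    by rewrite -(conjGid (subsetP sBG h Bh)) conjSg.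
  have prAJ : prime #|A :^ h| by rewrite cardJg.
  have [/(congr1 val) /= ->|/(congr1 val) /= E] := mAB (A :^ h)%G sAJ prAJ.
    exact: subxx.
  case/eqP: nAB; apply: val_inj => /=.
  by rewrite -[LHS](conjsgK h) E conjGid ?groupV.
have nSR : R \subset 'N(S) by apply: nJ => //; rewrite eq_sym.
have nRS' : S \subset 'N(R) by apply: nJ => // L sL prL; case: (minP L sL prL); auto.
have neqP (A B : {group gT}) : prime #|A| -> #|A| = #|B| -> A != B ->
    A :&: B = 1.
  move=> prA oAB nAB; apply: prime_TIg => //; apply: contraNN nAB => sAB.
  by rewrite -val_eqE /= eqEcard sAB oAB leqnn.
have tiRS : R :&: S = 1 by apply: neqP.
have cRS : R \subset 'C(S).
  by apply/commG1P/trivgP; rewrite -tiRS commg_subI // subsetI subxx.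
have [a defS] := cyclicP (prime_cyclic prS).
have [b defR] := cyclicP (prime_cyclic prR).
have Sa : a \in S by rewrite defS cycle_id.
have Rb : b \in R by rewrite defR cycle_id.
have cab : commute b a by apply: (centP (subsetP cRS b Rb)).
(* [b * a] generates a third subgroup of order #|S|. *)
have ab1 : (b * a) ^+ #|S| = 1.
  by rewrite expgMn // -{1}oRS !expg_cardG // mulg1.
have: #[b * a] %| #|S| by rewrite order_dvdn ab1.
case/primeP: (prS) => _ dvdS /dvdS /orP[|/eqP oba].
  rewrite order_eq1 => /eqP ba1.
  have : b \in R :&: S by rewrite inE Rb -(groupMr _ Sa) ba1 group1.
  rewrite tiRS => /set1P b1; move: prR.
  by rewrite defR b1 cycle1 cards1.
have sba : <[b * a]> \subset G.
  by rewrite cycle_subG groupM ?(subsetP sRG _ Rb) ?(subsetP sSG _ Sa).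
have Lba : b * a \in <[b * a]>%G by rewrite cycle_id.
have pba : prime #|<[b * a]>| by rewrite -orderE oba.
have [E|E] := minP <[b * a]>%G sba pba.
  have : b \in R :&: S by rewrite inE Rb -(groupMr _ Sa) -E Lba.
  by rewrite tiRS => /set1P b1; move: prR; rewrite defR b1 cycle1 cards1.
have : a \in R :&: S by rewrite inE Sa andbT -(groupMl _ Rb) -E Lba.
by rewrite tiRS => /set1P a1; move: prS; rewrite defS a1 cycle1 cards1.
Qed.

(** By Cauchy only [#|R|] and [#|S|] can divide the order of [G], so a Sylow [#|R|]-subgroup is a
    Hall complement to [S]. *)
Lemma sdprod_two_prime_subgroups (gT : finGroupType) (G R S T : {group gT}) :
  S <| G -> prime #|R| -> prime #|S| -> #|R| != #|S| -> #|S|.-Sylow(G) S ->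
  (forall L : {group gT}, L \subset G -> prime #|L| -> L = S \/ L = R) ->
  #|R|.-Sylow(G) T -> S ><| T = G.
Proof.
move=> nSG prR prS nRS sylS minP sylT.
apply/(sdprod_normal_p'HallP (pi := #|S|)) => //.
rewrite (@eq_in_pHall _ _ #|R|) // => q.
rewrite mem_primes => /and3P[q_pr _ /(Cauchy q_pr)[u Gu ou]].
have sub : <[u]>%G \subset G by rewrite cycle_subG.
have := minP <[u]>%G sub; rewrite -orderE ou => /(_ q_pr) E.
rewrite !inE; have : (q == #|S|) || (q == #|R|).
  by case: E => <-; rewrite -orderE ou eqxx ?orbT.
case/orP=> /eqP->; rewrite ?eqxx; last by rewrite nRS.
by rewrite eq_sym (negPf nRS).
Qed.

(** * Sylow conjugates of the complement *)

Section PrimeKernelSylow.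

Variables (gT : finGroupType) (G S T : {group gT}) (r : nat).
Hypotheses (defG : S ><| T = G) (prS : prime #|S|) (sylT : r.-Sylow(G) T).

Let outside := [set K in subgroups G | r.-group K] :\: subgroups T.

Lemma card_pgroups_outside :
  #|[set K in subgroups G | r.-group K]| = (#|outside| + #|subgroups T|)%N.
Proof.
rewrite -(cardsID (subgroups T) [set K in _ | _]) addnC; congr (_ + #|pred_of_set _|)%N.
apply/setIidPr/subsetP=> K; rewrite !inE => sKT.
by rewrite (subset_trans sKT (pHall_sub sylT)) (pgroupS sKT (pHall_pgroup sylT)).
Qed.

Lemma Syl_outside : 'Syl_r(G) :\ T \subset outside.
Proof.
apply/subsetP=> Q; rewrite !inE => /andP[nQT sylQ].
rewrite (pHall_sub sylQ) (pHall_pgroup sylQ) !andbT.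
apply: contraNN nQT => sQT; apply/eqP/val_inj/eqP => /=.
by rewrite eqEcard sQT (card_Hall sylQ) (card_Hall sylT) leqnn.
Qed.

(** The number of Sylow subgroups is the index of the normaliser of [T], which divides the prime
    [#|G : T| = #|S|]; it is 1 only for normal [T]. *)
Lemma card_Syl_prime_kernel : ~~ (T <| G) -> #|'Syl_r(G)| = #|S|.
Proof.
move=> nnT; have sTG := pHall_sub sylT.
have iTG : #|G : T| = #|S|.
  by rewrite -divgS // -(sdprod_card defG) mulnK ?cardG_gt0.
have sTN : T \subset 'N_G(T) by rewrite subsetI sTG normG.
have := Lagrange_index (subsetIl G 'N(T)) sTN; rewrite iTG => E.
have: #|'Syl_r(G)| %| #|S| by rewrite (card_Syl sylT) -E dvdn_mulr.
case/primeP: prS => _ dvdS /dvdS /orP[|/eqP//].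
rewrite (card_Syl sylT) indexg_eq1 subsetI subxx /= => nTG.
by case/negP: nnT; rewrite /normal sTG.
Qed.

End PrimeKernelSylow.

(** * From the star to the group *)

(** The group is identified by its order together with being a homomorphic image of the presented
    group. *)
Lemma homg_of_star (hT : finGroupType) (H : {group hT}) k :
  is_star (coint_graph H) k.+2 k ->
  #|H| = (3 * 2 ^ k)%N /\
  H \homg Grp (x : y : x ^+ 3, y ^+ (2 ^ k), x ^ y = x ^+ 2).
Proof.
case=> c [/star_TI cTI degc codegc]; set S := val c in cTI.
have /andP[ntS prpS] : (S :!=: 1) && (S \proper H) := valP c.
have sSH := proper_sub prpS.
have [v cv] : exists v, coint_adj c v.
  have /card_gt0P[v] : 0 < #|[set v : coint_graph H | adj c v]| by rewrite degc.
  by rewrite inE => cv; exists v.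
have /andP[ntv prpv] : (val v :!=: 1) && (val v \proper H) := valP v.
have tiSv : S :&: val v = 1 by case/andP: cv => _ /eqP.
have [R [prR sRv]] := prime_subgroup ntv.
have nt_pr (L : {group hT}) : prime #|L| -> L :!=: 1.
  by move=> /prime_gt1; rewrite cardG_gt1.
have prpR := sub_proper_trans sRv prpv; have sRH := proper_sub prpR.
have tiSR : S :&: R = 1 by apply/trivgP; rewrite -tiSv setIS.
have nRS : R != S.
  by apply: contraNneq ntS => E; rewrite -tiSR E setIid.
have prS : prime #|S|.
  (* A prime-order subgroup [P] of [S] still meets [R] trivially, so the star condition makes it the
     centre. *)
  have [P [prP sPS]] := prime_subgroup ntS.
  have tiRP : R :&: P = 1 by apply/trivgP; rewrite -tiSR /= setIC setSI.
  have [E|<- //] := cTI R P (nt_pr _ prR) (nt_pr _ prP) prpR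
    (sub_proper_trans sPS prpS) tiRP.
  by rewrite E eqxx in nRS.
have minP (L : {group hT}) : L \subset H -> prime #|L| -> L = S \/ L = R.
  move=> sLH prL; have [<-|nLR] := eqVneq L R; first by right.
  left; have prpL : L \proper H.
    rewrite properEneq sLH andbT; apply: contraTneq (prpS) => E.
    have nLS : ~~ (L \subset S) by rewrite E; case/andP: prpS.
    have := prime_TIg prL nLS; rewrite E (setIidPr sSH) => S1.
    by rewrite S1 eqxx in ntS.
  have tiLR : L :&: R = 1.
    apply: prime_TIg => //; apply: contraNN nLR => sLR.
    by rewrite -val_eqE eqEcard sLR dvdn_leq ?cardG_gt0 //= dvdn_prime2 //
       eq_sym -dvdn_prime2 // cardSg.
  have [//|E] := cTI L R (nt_pr _ prL) (nt_pr _ prR) prpL prpR tiLR.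
  by rewrite E eqxx in nRS.
have nRSc := two_prime_subgroups_order sRH sSH prR prS nRS minP.
have nSH : S <| H.
  rewrite /normal sSH; apply/subsetP=> h Hh; rewrite inE.
  have sSJ : S :^ h \subset H by rewrite -(conjGid Hh) conjSg.
  have prSJ : prime #|S :^ h| by rewrite cardJg.
  have [/(congr1 val) /= ->|/(congr1 val) /= E] := minP (S :^ h)%G sSJ prSJ.
    exact: subxx.
  by case/eqP: nRSc; rewrite -E cardJg.
(* A Sylow subgroup [P] containing [S] has order coprime to [#|R|], so [P] and [R] are adjacent and
   [P] must be the centre. *)
have sylS : #|S|.-Sylow(H) S.
  have [P sylP sSP] := Sylow_superset sSH (pnat_id prS).
  have coPR : coprime #|P| #|R|.
    apply: (pnat_coprime (pHall_pgroup sylP)).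
    by rewrite p'natE // dvdn_prime2 // eq_sym.
  have tiPR := coprime_TIg coPR.
  have prpP : P \proper H.
    rewrite properEneq (pHall_sub sylP) andbT.
    apply: contraTneq prR => E; rewrite -(setIidPr sRH) -E tiPR.
    by rewrite cards1.
  have ntP : P :!=: 1 by apply: contraNneq ntS => P1; rewrite -subG1 -P1.
  have [E|E] := cTI P R ntP (nt_pr _ prR) prpP prpR tiPR.
    by move: sylP; rewrite E.
  by rewrite E eqxx in nRS.
set r := #|R|.
have [T sylT] := Sylow_exists r H.
have defH := sdprod_two_prime_subgroups nSH prR prS nRSc sylS minP sylT.
have rT := pHall_pgroup sylT.
have r'S : r^'.-group S.
  by rewrite /pgroup p'natE // dvdn_prime2 // eq_sym.
(* The [k.+2] leaves and the trivial subgroup. *)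
have away : #|[set K in subgroups H | r.-group K]| = k.+3.
  by rewrite -(star_degree defH prS rT r'S (erefl : val c = S)) degc.
(* The [k] non-neighbours of the centre, itself included, and the whole group [H]. *)
have over : #|subgroups T| = k.+1.
  by rewrite -(star_codegree defH prS rT r'S (erefl : val c = S)) codegc.
rewrite (card_pgroups_outside sylT) over -(add2n k.+1) in away.
have {}away : #|[set K in subgroups H | r.-group K] :\: subgroups T| = 2.
  exact: addIn away.
have nnT : ~~ (T <| H).
  apply/negP=> nTH.
  have /card_gt0P[K] : 0 <
    #|[set K in subgroups H | r.-group K] :\: subgroups T|.
    by rewrite away.
  by rewrite !inE => /and3P[+ sKH rK]; rewrite (sub_normal_Hall sylT nTH sKH) rK.
have oSyl := card_Syl_prime_kernel defH prS sylT nnT.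
have sylTT : T \in 'Syl_r(H) by rewrite inE.
have Syl1 : #|'Syl_r(H) :\ T| = #|S|.-1.
  by have := cardsD1 T 'Syl_r(H); rewrite sylTT oSyl => ->.
have le2 : #|S|.-1 <= 2 by rewrite -Syl1 -away subset_leq_card ?Syl_outside.
have mod1 := card_Syl_mod H prR; rewrite -/r oSyl in mod1.
(* The bound leaves [#|S|] equal to 2 or 3, and it is 1 modulo [r] by Sylow; 2 is never 1 modulo a
   prime, and 3 is so only modulo 2. *)
have [oS oR] : #|S| = 3 /\ r = 2.
  have small s q :
      prime s -> prime q -> s.-1 <= 2 -> (s %% q = 1)%N -> s = 3 /\ q = 2.
    by case: s q => [|[|[|[|]]]] // [|[|[|[|]]]] //= q _ _ _; rewrite modn_small.
  exact: small prS prR le2 mod1.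
have defSyl : 'Syl_r(H) :\ T = [set K in subgroups H | r.-group K] :\: subgroups T.
  by apply/eqP; rewrite eqEcard Syl_outside // Syl1 away oS.
have [Q] : exists Q, Q \in 'Syl_r(H) :\ T.
  by apply/card_gt0P; rewrite Syl1 oS.
rewrite !inE => /andP[nQT sylQ].
have [h Hh defQ] := Sylow_trans sylT sylQ.
(* A conjugate of <[t]> lies outside T, hence is a Sylow subgroup: T = <[t]>. *)
have [t Tt nQt] : exists2 t, t \in T & t \notin Q.
  apply/subsetPn; apply: contraNN nQT => sTQ.
  by rewrite eq_sym -val_eqE eqEcard sTQ (card_Hall sylQ) (card_Hall sylT) leqnn.
have sTH := pHall_sub sylT; have Ht := subsetP sTH t Tt.
have : (<[t]> :^ h^-1)%G \in 'Syl_r(H) :\ T.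
  have rt : r.-group <[t]> := mem_p_elt rT Tt.
  rewrite defSyl !inE pgroupJ rt andbT.
  rewrite -(conjGid (groupVr Hh)) conjSg cycle_subG Ht andbT.
  by rewrite sub_conjgV -defQ cycle_subG.
rewrite !inE => /andP[_ /card_Hall]; rewrite cardJg -(card_Hall sylT) => ot.
have defT : T = <[t]>%G.
  by apply/eqP; rewrite -val_eqE eq_sym eqEcard cycle_subG Tt -ot leqnn.
have [m oT] := p_natP rT; rewrite oR in oT.
have cT : cyclic T by rewrite defT cycle_cyclic.
have [m_k] : m.+1 = k.+1.
  by rewrite -over (card_subgroups_cyclic_pgroup _ cT oT).
rewrite m_k in oT.
have oH : #|H| = (3 * 2 ^ k)%N by rewrite -(sdprod_card defH) oS oT.
split=> //.
have [a defS] := cyclicP (prime_cyclic prS).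
have oa : #[a] = 3 by rewrite orderE -defS.
have Sa : a \in S by rewrite defS cycle_id.
have [_ _ mulST nST _] := sdprod_context defH.
have /cycleP[i] : a ^ t \in <[a]>.
  by rewrite -defS memJ_norm ?(subsetP nST).
move=> ati.
apply/existsP; exists (a, t); rewrite /= !xpair_eqE; apply/and4P; split.
- by rewrite -defS -[<[t]>]/(val <[t]>%G) -defT norm_joinEr ?mulST.
- by rewrite -oa expg_order.
- by rewrite -oT defT -orderE expg_order.
(* Exponent 0 would make [a] trivial, and exponent 1 would make [t] centralise [S], so that [T]
   would be normal; only inversion remains. *)
have: i %% 3 < 3 by rewrite ltn_mod.
rewrite -(expg_mod_order a i) oa in ati.
move: ati; case: (i %% 3) => [|[|[|]]] // ati _; last by rewrite ati.
  have a1 : a = 1 by apply: (conjg_inj t); rewrite ati conj1g.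
  by rewrite a1 order1 in oa.
case/negP: nnT; rewrite /normal sTH -mulST mulG_subG normG andbT.
rewrite cents_norm // defS cycle_subG defT /= cent_cycle.
by apply/cent1P/commgP/conjg_fixP; rewrite ati.
Qed.

(** * From the group to the star *)

(** The relations only bound the orders of [x] and [y]; the order of [G] makes these bounds exact.
    For [k = 1] the group would be the symmetric group on three points, whose three involutions
    spoil the star. *)
Lemma star_of_relations (gT : finGroupType) (G : {group gT}) (x y : gT) k :
  1 < k -> #|G| = (3 * 2 ^ k)%N -> x ^+ 3 = 1 -> y ^+ (2 ^ k) = 1 ->
  x ^ y = x ^+ 2 -> <[x]> <*> <[y]> = G -> is_star (coint_graph G) k.+2 k.
Proof.
move=> k_gt1 oG x3 y2k xy genG.
have nST : <[y]> \subset 'N(<[x]>) by rewrite norms_cycle xy mem_cycle.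
have dvdx : #[x] %| 3 by rewrite order_dvdn x3.
have dvdy : #[y] %| 2 ^ k by rewrite order_dvdn y2k.
have co3 : coprime 3 (2 ^ k) by rewrite coprimeXr.
have coST : coprime #[x] #[y].
  by apply: coprime_dvdl dvdx _; apply: coprime_dvdr dvdy _.
have tiST : <[x]> :&: <[y]> = 1 := coprime_TIg coST.
have defG : <[x]> ><| <[y]> = G by rewrite sdprodE // -norm_joinEr.
have oxy : (#[x] * #[y])%N = (3 * 2 ^ k)%N by rewrite -oG -(sdprod_card defG).
have ox : #[x] = 3.
  have /primeP[_ /(_ _ dvdx)] : prime 3 by [].
  case/orP=> /eqP // x1; move: oxy; rewrite x1 mul1n => oy.
  by move: dvdy; rewrite oy => /dvdn_leq; rewrite expn_gt0 /=
    -[X in _ <= X]mul1n leq_pmul2r ?expn_gt0 // => /(_ isT).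
have oy : #[y] = (2 ^ k)%N by apply/eqP; rewrite -(@eqn_pmul2l 3) // -oxy ox.
have prS : prime #|<[x]>| by rewrite -orderE ox.
have rT : 2.-group <[y]> by rewrite /pgroup -orderE oy pnatX pnat_id.
have r'S : 2^'.-group <[x]> by rewrite /pgroup -orderE ox.
have [nSG sTG _ _ _] := sdprod_context defG.
have [Gx Gy] : x \in G /\ y \in G.
  by rewrite -!cycle_subG (normal_sub nSG).
have sylT : 2.-Sylow(G) <[y]>.
  rewrite pHallE sTG /= -orderE oy oG partnM // ?expn_gt0 //.
  by rewrite part_p'nat // part_pnat_id ?mul1n // pnatX pnat_id.
(* Otherwise the commutator of [x] and [y] lies in both factors, so [y] centralises [x] and
   [x ^+ 2 = x]. *)
have nnT : ~~ (<[y]> <| G).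
  apply/negP=> nTG; have : [~ x, y] \in <[x]> :&: <[y]>.
    rewrite inE {1}commgEl groupMl ?groupV ?cycle_id // xy mem_cycle //=.
    rewrite commgEr groupMr ?cycle_id //.
    by rewrite memJ_norm ?groupV ?cycle_id // (subsetP (normal_norm nTG)).
  rewrite tiST => /set1P/eqP/conjg_fixP; rewrite xy expgS -[RHS]mulg1.
  by move/mulgI => x1; rewrite -[x]expg1 x1 order1 in ox.
(* The subgroup of index 2 in [<[y]>]. It is central, since inverting [x] twice fixes it. *)
pose W := <[y ^+ 2]>%G.
have oW : #|W| = (2 ^ k.-1)%N.
  rewrite /W /= -orderE orderXdiv oy; last by rewrite dvdn_exp // ltnW.
  by rewrite -{1}(prednK (ltnW k_gt1)) expnS mulKn.
have sWT : W \subset <[y]> by rewrite cycleX.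
have cWG : W \subset 'C(G).
  rewrite -genG cycle_subG /= centY inE !cent_cycle; apply/andP; split.
    apply/cent1P/esym/commgP/conjg_fixP.
    by rewrite expgS expg1 conjgM xy conjXg xy -expgM (expgD x 3 1) x3 mul1g.
  by apply/cent1P/esym/commuteX.
(* Some conjugate of [K] lies in the cyclic group [<[y]>], where divisibility of orders is
   inclusion; conjugating back preserves the central [W]. *)
have subW (K : {group gT}) :
    K \subset G -> 2.-group K -> #|K| %| 2 ^ k.-1 -> K \subset W.
  move=> sKG rK dvdK; have [g Gg sKT] := Sylow_Jsub sylT sKG rK.
  have : K :^ g \subset W.
    by rewrite -(cardSg_cyclic (cycle_cyclic y) sKT sWT) cardJg oW.
  have nWg : W :^ g = W.
    have /cents_norm/subsetP nWG : G \subset 'C(W) by rewrite centsC.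
    exact: normP (nWG g Gg).
  by rewrite -{1}nWg conjSg.
(* A 2-subgroup of order below [2 ^ k] lies in [W], so those outside [<[y]>] are the other Sylow
   subgroups, [3 - 1] in number. *)
have out2 : #|[set K in subgroups G | 2.-group K] :\: subgroups <[y]>| = 2.
  have := cardsD1 <[y]>%G 'Syl_2(G).
  rewrite (card_Syl_prime_kernel defG prS sylT nnT) inE sylT -orderE ox => -[E].
  apply: etrans (esym E); apply: eq_card => K; apply/idP/idP; last first.
    by move/(subsetP (Syl_outside sylT)).
  rewrite !inE => /and3P[nKT sKG rK].
  have KT : K != <[y]>%G by apply: contraNneq nKT => ->.
  rewrite KT /= pHallE sKG /= -(card_Hall sylT) -orderE oy.
  have sKT : exists2 i, i <= k & #|K| = (2 ^ i)%N.
    apply/(dvdn_pfactor _ _ (isT : prime 2)).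
    by rewrite -oy orderE -(Gauss_dvdr _ (pnat_coprime rK r'S)) (sdprod_card defG) cardSg.
  have [i le_ik oK] := sKT; rewrite oK eqn_exp2l // eqn_leq le_ik /=.
  apply: contraNT nKT; rewrite -ltnNge => lt_ik.
  apply: subset_trans (subW K sKG rK _) sWT.
  by rewrite oK dvdn_exp2l // -ltnS prednK // ltnW.
have oT : #|subgroups <[y]>| = k.+1.
  by rewrite (@card_subgroups_cyclic_pgroup _ _ 2 k) ?cycle_cyclic.
have oaway := card_pgroups_outside sylT; rewrite out2 oT in oaway.
have vS : (<[x]> != 1) && (<[x]> \proper G).
  rewrite -cardG_gt1 -orderE ox /= properEcard (normal_sub nSG) oG -orderE ox.
  by rewrite ltn_Pmulr // -{1}(expn0 2) ltn_exp2l // ltnW.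
pose c : coint_vertex G := Sub <[x]>%G vS.
exists c; split; last 2 first.
- apply: succn_inj; apply: etrans oaway; exact: (star_degree defG prS rT r'S).
- apply: succn_inj; rewrite -oT; exact: (star_codegree defG prS rT r'S).
(* An involution of [u] lies in [W] because [1 < k]. A vertex of odd order contains [x] and has
   order dividing 3, so it is [c]. *)
have even (u : coint_vertex G) : u != c ->
    exists w, [/\ w \in val u, #[w] = 2 & w \in W].
  move=> ncu; have /andP[ntu /proper_sub suG] := valP u.
  have [ev|od] := boolP (2 %| #|val u|).
    have [w uw ow] := Cauchy (isT : prime 2) ev.
    exists w; split=> //; rewrite -cycle_subG (subW <[w]>%G) //.
    - by rewrite cycle_subG (subsetP suG).
    - by rewrite /pgroup -orderE ow.
    by rewrite -orderE ow dvdn_exp // -ltnS prednK // ltnW.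
  have r'u : 2^'.-group (val u) by rewrite /pgroup p'natE.
  case/eqP: ncu; apply: val_inj; apply/eqP; rewrite eq_sym -val_eqE eqEcard /=.
  have -> /= : <[x]> \subset val u.
    apply: contraNT ntu => nxu.
    have ru : 2.-group (val u) by rewrite (pgroup_prime_kernel defG).
    by rewrite -(setIid (val u)) (coprime_TIg (pnat_coprime ru r'u)).
  rewrite -orderE ox dvdn_leq // -(@Gauss_dvdl _ _ (2 ^ k)) -?oG ?cardSg //.
  by rewrite coprimeXr // coprime_sym prime_coprime.
move=> u v /andP[_ /eqP tiuv].
have [->|/even[w [uw ow Ww]]] := eqVneq u c; first by left.
have [->|/even[w' [vw ow' Ww']]] := eqVneq v c; first by right.
(* The cyclic group [W] has only one subgroup of order 2, so [u] and [v] share an involution. *)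
have E : <[w]> = <[w']>.
  apply/eqP; rewrite (eq_subG_cyclic (cycle_cyclic (y ^+ 2))) ?cycle_subG //.
  by rewrite -!orderE ow ow'.
have : w \in val u :&: val v.
  by rewrite inE uw -cycle_subG E cycle_subG.
by rewrite tiuv => /set1P w1; rewrite w1 order1 in ow.
Qed.

(** * The family of groups and the conclusion *)

(** The arguments are the orders of kernel and complement and the exponent of the action; exponent 2
    is inversion modulo 3. The construction defaults to the trivial action when no suitable
    automorphism exists, so one has to be exhibited for the presentation. *)
Definition C3_C2k k : finGroupType := Extremal.gtype 3 (2 ^ k) 2.

Lemma card_C3_C2k k : 0 < k -> #|[set: C3_C2k k]| = (3 * 2 ^ k)%N.
Proof.
move=> k0; have k1 : 1 < 2 ^ k by rewrite -{1}(expn0 2) ltn_exp2l.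
by rewrite [RHS]mulnC; apply: (Extremal.card _ k1).
Qed.

Lemma C3_C2k_Grp k : 0 < k ->
  [set: C3_C2k k] \isog Grp (x : y : x ^+ 3, y ^+ (2 ^ k), x ^ y = x ^+ 2).
Proof.
move=> k_gt0; have k1 : 1 < 2 ^ k by rewrite -{1}(expn0 2) ltn_exp2l.
apply: Extremal.Grp => //.
set b := Zp1; have ob : #[b] = 3 by rewrite order_Zp1.
(* The automorphism group of the cyclic group of order 3 has order 2. Its involution must send [b]
   to [b ^+ 2], since [b ^+ 0] breaks injectivity and [b ^+ 1] gives the identity. *)
have [s Auts os] : {s | s \in Aut <[b]> & #[s] = 2}.
  by apply: Cauchy; rewrite // card_Aut_cycle ob.
exists s; split=> //; first by rewrite os dvdn_exp.
have /cycleP[i sbi] : s b \in <[b]> by rewrite Aut_closed ?cycle_id.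
have: i %% 3 < 3 by rewrite ltn_mod.
move: sbi; rewrite -(expg_mod_order b i) ob.
case: (i %% 3) => [|[|[|]]] // sb _.
  have : b = 1 by apply: (@perm_inj _ s); rewrite sb -(autmE Auts) morph1.
  by move=> b1; rewrite b1 order1 in ob.
suff s1 : s = 1 by rewrite s1 order1 in os.
apply: (eq_Aut Auts (group1 _)) => _ /cycleP[j ->].
by rewrite -(autmE Auts) morphX ?cycle_id //= autmE sb perm1.
Qed.

Lemma metacyclic_C3_C2k k : 0 < k -> metacyclic [set: C3_C2k k].
Proof.
move/C3_C2k_Grp/isoGrp_hom=> /existsP[[x y]] /=.
case/eqP=> genG _ _ xy; apply/metacyclicP; exists <[x]>%G.
have nST : <[y]> \subset 'N(<[x]>) by rewrite norms_cycle xy mem_cycle.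
rewrite cycle_cyclic /normal subsetT -genG join_subG normG nST; split=> //.
by rewrite quotientYidl // quotient_cyclic ?cycle_cyclic.
Qed.

(** The graph of the model is a star, hence so is that of [H]; then [H] is a homomorphic image of
    the model of the same order, hence isomorphic to it. *)
Lemma C3_C2k_determined k : 1 < k -> determined_by_coint_graph [set: C3_C2k k].
Proof.
move=> k_gt1 hT H /is_star_iso iGH; have k_gt0 := ltnW k_gt1.
have isoG := C3_C2k_Grp k_gt0; have oG := card_C3_C2k k_gt0.
have /iGH/homg_of_star[oH homH] : is_star (coint_graph [set: C3_C2k k]) k.+2 k.
  have /existsP[[x y]] := isoGrp_hom isoG.
  by case/eqP=> genG x3 y2k xy; apply: star_of_relations genG.
by rewrite isog_sym isogEcard isoG homH oG oH leqnn.
Qed.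

Theorem proposition1p8 :
  infinitely_many_groups_up_to_isog
    (fun (gT : finGroupType) (G : {group gT}) => determined_by_coint_graph G) /\
  infinitely_many_groups_up_to_isog
    (fun (gT : finGroupType) (G : {group gT}) =>
       metacyclic G /\ determined_by_coint_graph G).
Proof.
(* The orders [3 * 2 ^ k] separate the groups; the shift by 2 ensures [1 < k]. *)
have inj m n : [set: C3_C2k m.+2] \isog [set: C3_C2k n.+2] -> m = n.
  move/card_isog/eqP; rewrite !card_C3_C2k // eqn_pmul2l // eqn_exp2l //.
  by move/eqP=> [].
split; exists (fun n => C3_C2k n.+2), (fun n => [set: C3_C2k n.+2]%G); split=> //.
- by move=> n; apply: C3_C2k_determined.
- by move=> n; split; [apply: metacyclic_C3_C2k | apply: C3_C2k_determined].
Qed.
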